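(* For any $k\ge 2$, the maximum number of maximal cliques over all $n$-vertex graphs in $k\text{-DIR}$ is $\Omega(n^{k(1-\epsilon)})$, for any $\epsilon>0$. Moreover, if $k$ is a constant, then the bound is $\Omega(n^{k})$.
   Context: For a collection of sets, its intersection graph has one vertex for each member of the collection, and two distinct vertices are adjacent if and only if the corresponding sets have nonempty intersection. $k\text{-DIR}$ is the class of intersection graphs of collections of straight-line segments in the plane in which all the segments are parallel to at most $k$ directions. Maximal cliques are maximal with respect to inclusion.
   Formalization: In the first sentence k may depend on n, and the formal version adds the condition k = n^{o(1)}; without it the claim fails (k = n would give more than 2^n cliques). Every fixed k ≥ 2 is covered. *)

(* Defs.v *)
From mathcomp Require Import all_boot all_order all_algebra.
From mathcomp Require Import all_classical all_reals all_analysis.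

Set Implicit Arguments.
Unset Strict Implicit.
Unset Printing Implicit Defensive.

Import Order.TTheory GRing.Theory Num.Theory.
Import numFieldNormedType.Exports.

Local Open Scope classical_set_scope.
Local Open Scope ring_scope.

(* A graph on the vertex set T is given by its adjacency relation, seen as a
   set of ordered pairs.  Intersection graphs are automatically symmetric and
   irreflexive.  A collection is an indexed family, so repeated members are
   allowed and count as distinct vertices. *)
Definition intersection_graph (T : finType) (U : Type) (S : T -> set U) :
    {set T * T} :=
  [set e : T * T | (e.1 != e.2) && `[< S e.1 `&` S e.2 !=set0 >]]%SET.

Definition closed_segment (R : realType) (p q : 'rV[R]_2) : set 'rV[R]_2 :=
  [set (1 - t) *: p + t *: q | t in `[0, 1]%classic].

(* The k direction vectors d need not be pairwise non-parallel, whence "at most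
   k directions".  Segments are closed and non-degenerate. *)
Definition in_kDIR (R : realType) (k : nat) (T : finType)
    (G : {set T * T}) : Prop :=
  exists (p q : T -> 'rV[R]_2) (d : 'I_k -> 'rV[R]_2),
    [/\ forall i, p i != q i,
        forall j, d j != 0,
        forall i, exists j : 'I_k, exists t : R, q i - p i = t *: d j
      & G = intersection_graph (fun i => closed_segment (p i) (q i))].

Definition is_clique (T : finType) (G : {set T * T}) (A : {set T}) : bool :=
  [forall x in A, forall y in A, (x != y) ==> ((x, y) \in G)].

Definition maximal_cliques (T : finType) (G : {set T * T}) : {set {set T}} :=
  [set A : {set T} | maxset (is_clique G) A]%SET.

Definition max_num_maximal_cliques (R : realType) (k n : nat) : nat :=
  (\max_(G : {set 'I_n * 'I_n} | `[< in_kDIR R k G >]) #|maximal_cliques G|)%N.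

(* k(n) = n^{o(1)}: the range in which a number k of directions depending on n
   can yield Omega(n^{k (1 - eps)}) maximal cliques for every eps > 0, as
   (n / k)^k = n^{k (1 - log k / log n)}; for k(n) = n the bound would exceed the
   number 2^n of vertex sets. *)
Definition subpolynomial (R : realType) (k : nat -> nat) : Prop :=
  forall delta : R, 0 < delta ->
    \forall n \near \oo, (k n)%:R <= (n%:R : R) `^ delta.

Lemma subpolynomial_cst (R : realType) (k : nat) :
  subpolynomial R (fun=> k).
Proof.
move=> delta d0.
exists (Num.truncn ((k%:R : R) `^ delta^-1)).+1 => // n /= hn.
have d0' : delta != 0 by rewrite gt_eqF.
have -> : (k%:R : R) = (k%:R `^ delta^-1) `^ delta.
  by rewrite -powRrM mulVf// powRr1.
apply: ge0_ler_powR; rewrite ?nnegrE ?powR_ge0 ?ler0n ?ltW//.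
by apply: lt_le_trans (truncnS_gt _) _; rewrite ler_nat.
Qed.

(* Main.v *)
Require Import Defs.
From mathcomp Require Import all_boot all_order all_algebra.
From mathcomp Require Import all_classical all_reals all_analysis.
From mathcomp Require Import ring lra.

Import Order.TTheory GRing.Theory Num.Theory.
Import numFieldNormedType.Exports.

Local Open Scope classical_set_scope.
Local Open Scope ring_scope.

(* The vertices 0, ..., n - 1 are split by their residue modulo k.  Vertex i is
   the piece over [-n, n] of the line of slope i mod k and intercept i.  Two
   lines of the same slope are parallel and distinct; since distinct slopes
   differ by at least 1, lines i and i' of different slopes meet at an abscissa
   of absolute value at most |i' - i| <= n.  The graph is therefore complete
   k-partite with parts of size at least floor(n / k) >= n / (2k), and choosing
   one vertex in each part gives at least (n / (2k))^k maximal cliques.  When k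
   is subpolynomial, 2k <= n^eps eventually. *)

(** Each choice function [f] gives a transversal of the parts. It determines [f], since its only
    vertex in part [j] is [s j (f j)]. Parts may have more than the [m] vertices listed by [s]. *)
Lemma card_maximal_cliques_multipartite (T : finType) (k m : nat)
    (G : {set T * T}) (c : T -> 'I_k) (s : 'I_k -> 'I_m -> T) :
  (forall j, injective (s j)) -> (forall j a, c (s j a) = j) ->
  (forall x y, ((x, y) \in G) = (c x != c y)) ->
  (m ^ k <= #|maximal_cliques G|)%N.
Proof.
move=> s_inj cs GE.
pose A (f : {ffun 'I_k -> 'I_m}) := [set s j (f j) | j : 'I_k]%SET.
have A_inj : injective A.
  move=> f g fg; apply/ffunP => j.
  have /imsetP[j' _ e] : s j (f j) \in A g by rewrite -fg imset_f.
  have jj' : j = j' by rewrite -(cs j (f j)) e cs.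
  by move: e; rewrite -jj' => /s_inj.
have -> : (m ^ k = #|A @: [set: {ffun 'I_k -> 'I_m}]%SET|)%N.
  by rewrite (card_imset _ A_inj) cardsT card_ffun !card_ord.
apply/subset_leq_card/fintype.subsetP => _ /imsetP[f _ ->].
rewrite inE; apply/maxsetP; split.
  apply/forall_inP => _ /imsetP[i _ ->]; apply/forall_inP => _ /imsetP[j _ ->].
  by apply/implyP; rewrite GE !cs; apply: contraNneq => ->.
move=> B /forall_inP cliqueB subAB; apply/eqP; rewrite finset.eqEsubset subAB andbT.
apply/fintype.subsetP => b bB.
(* Compare [b] with the chosen vertex of its own part: if they differed, they would be non-adjacent
   inside the clique [B]. *)
have aA : s (c b) (f (c b)) \in A f by rewrite imset_f.
suff -> : b = s (c b) (f (c b)) by [].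
apply/eqP; apply: contraT => ba.
have /forall_inP/(_ _ (fintype.subsetP subAB _ aA)) := cliqueB b bB.
by rewrite ba GE cs eqxx.
Qed.

(** With [b = 0] and [x = 1] this is also the direction vector (1, a), nonzero for every slope. *)
Definition graph_point (R : realType) (a b x : R) : 'rV[R]_2 :=
  \row_(j < 2) (if j == 0 then x else a * x + b).

Lemma graph_pointB (R : realType) (a b x y : R) :
  graph_point R a b y - graph_point R a b x = (y - x) *: graph_point R a 0 1.
Proof. by apply/rowP => j; rewrite !mxE; case: ifP => _; ring. Qed.

Lemma closed_segment_graphP (R : realType) (a b r : R) (z : 'rV[R]_2) :
  0 < r ->
  closed_segment (graph_point R a b (- r)) (graph_point R a b r) z <->
  `|z 0 0| <= r /\ z = graph_point R a b (z 0 0).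
Proof.
move=> r0; split.
  case=> t /=; rewrite in_itv /= => /andP[t0 t1] <-; split.
    by rewrite !mxE /= ler_norml; apply/andP; split; nra.
  by apply/rowP => j; rewrite !mxE /=; case: ifP => // _; ring.
case; rewrite ler_norml => /andP[xl xr] ->.
(* The solution t of (1 - t)(-r) + t r = [z 0 0]. *)
exists ((z 0 0 / r + 1) / 2) => /=.
  have : z 0 0 / r <= 1 by rewrite ler_pdivrMr// mul1r.
  have : - 1 <= z 0 0 / r by rewrite ler_pdivlMr// mulN1r.
  by rewrite in_itv /= => *; apply/andP; split; lra.
apply/rowP => j; rewrite !mxE.
by have r0' : r != 0 := lt0r_neq0 r0; case: ifP => _; field.
Qed.

(** Non-parallel lines cross at abscissa (b' - b) / (a - a'), which the last hypothesis places in
    [-r, r]; a common point of parallel ones would force equal intercepts. *)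
Lemma closed_segment_graph_meet (R : realType) (a b a' b' r : R) :
  0 < r -> b != b' -> (a != a' -> `|b' - b| <= r * `|a - a'|) ->
  (closed_segment (graph_point R a b (- r)) (graph_point R a b r) `&`
   closed_segment (graph_point R a' b' (- r)) (graph_point R a' b' r) !=set0)
  <-> a != a'.
Proof.
move=> r0 bb' rP; split.
  case=> z [/(closed_segment_graphP _ _ _ _ _ r0)[_ e]].
  move=> /(closed_segment_graphP _ _ _ _ _ r0)[_ e'].
  apply: contra_neq bb' => aa'; move: e'; rewrite e => /rowP/(_ 1).
  by rewrite !mxE /= aa' => /addrI.
move=> aa'; have aa0 : a - a' != 0 by rewrite subr_eq0.
have xr : `|(b' - b) / (a - a')| <= r.
  by rewrite normf_div ler_pdivrMr ?normr_gt0// rP.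
exists (graph_point R a b ((b' - b) / (a - a'))).
split; apply/closed_segment_graphP => //; split; rewrite !mxE//=.
by apply/rowP => j; rewrite !mxE; case: ifP => // _; field.
Qed.

Lemma normr_natB_ge1 (R : realDomainType) (m n : nat) :
  m != n -> 1 <= `|m%:R - n%:R| :> R.
Proof.
wlog mn : m n / (m < n)%N.
  move=> h mn; case: (ltngtP m n) => [lt|lt|e].
  - exact: h.
  - by rewrite distrC h// eq_sym.
  - by rewrite e eqxx in mn.
by move=> _; rewrite distrC -natrB 1?ltnW// normr_nat ler1n subn_gt0.
Qed.

Lemma in_kDIR_multipartite (R : realType) (k n : nat) : (0 < k)%N ->
  in_kDIR R k [set e : 'I_n * 'I_n | (e.1 %% k != e.2 %% k)%N]%SET.
Proof.
move=> k0; pose r : R := n%:R.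
pose a (i : 'I_n) : R := (i %% k)%:R.
(* Positivity comes from the existence of a vertex, so [n = 0] needs no separate case. *)
have r0 (i : 'I_n) : 0 < r by rewrite ltr0n (leq_ltn_trans _ (ltn_ord i)).
exists (fun i => graph_point R (a i) i%:R (- r)).
exists (fun i => graph_point R (a i) i%:R r).
exists (fun j : 'I_k => graph_point R j%:R 0 1); split.
- move=> i; apply/eqP => /rowP/(_ 0); rewrite !mxE /= => /eqP.
  by rewrite eqNr (gt_eqF (r0 i)).
- by move=> j; apply/eqP => /rowP/(_ 0); rewrite !mxE /= => /eqP; rewrite oner_eq0.
- move=> i; exists (Ordinal (ltn_pmod i k0)), (r - - r).
  exact: graph_pointB.
- have bound (i j : 'I_n) : a i != a j -> `|j%:R - i%:R| <= r * `|a i - a j|.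
    rewrite eqr_nat => /normr_natB_ge1-/(_ R) aij.
    have ir : i%:R <= r by rewrite ler_nat ltnW.
    have jr : j%:R <= r by rewrite ler_nat ltnW.
    (* Both intercepts lie in [0, n], and distinct integer slopes differ by at least 1. *)
    apply: (@le_trans _ _ r); last by rewrite ler_peMr// ltW// r0.
    rewrite ler_distl (le_trans jr) ?lerDr// andbT.
    by apply: (@le_trans _ _ 0); rewrite ?subr_le0.
  apply/setP => -[i j]; rewrite !inE /=.
  have [<-|ij] := eqVneq i j; first by rewrite eqxx.
  have ij_nat : i%:R != j%:R :> R by rewrite eqr_nat.
  have meetP := closed_segment_graph_meet _ _ _ _ _ _ (r0 i) ij_nat (bound i j).
  by rewrite /= -(eqr_nat R); apply/idP/asboolP => /meetP.
Qed.

Lemma max_num_maximal_cliques_ge (R : realType) (k n : nat) : (0 < k)%N ->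
  ((n %/ k) ^ k <= max_num_maximal_cliques R k n)%N.
Proof.
move=> k0.
(* The residue class of [j] is listed as a k + j, which stays below (a + 1) k <= n. *)
have lt_s (j : 'I_k) (a : 'I_(n %/ k)) : (a * k + j < n)%N.
  apply: leq_trans (leq_divM n k); apply: leq_trans (leq_mul (ltn_ord a) (leqnn k)).
  by rewrite mulSn addnC ltn_add2r.
pose s j a : 'I_n := Ordinal (lt_s j a).
pose c (i : 'I_n) : 'I_k := Ordinal (ltn_pmod i k0).
apply: leq_trans (leq_bigmax_cond _ _); last first.
  exact/asboolP/(in_kDIR_multipartite R k n k0).
apply: (card_maximal_cliques_multipartite _ _ _ _ c s) => [j a b|j a|x y].
- move=> /(congr1 val)/= /addIn/eqP; rewrite eqn_pmul2r// => /eqP.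
  exact: val_inj.
- by apply: val_inj; rewrite /= modnMDl modn_small.
- by rewrite inE.
Qed.

(** With q the quotient, n < (q + 1) k <= 2 q k, because [k <= n] gives q >= 1. *)
Lemma divn_ge_half (R : realFieldType) (k n : nat) : (0 < k <= n)%N ->
  n%:R / (2 * k%:R) <= (n %/ k)%:R :> R.
Proof.
case/andP=> k0 kn; rewrite ler_pdivrMr ?mulr_gt0 ?ltr0n//.
rewrite -!natrM ler_nat (leq_trans (ltnW (ltn_ceil n k0)))//.
by rewrite mulnA leq_mul2r muln2 -addnn -addn1 leq_add2l divn_gt0// kn orbT.
Qed.

Theorem theorem4 (R : realType) :
  (forall k : nat -> nat,
     (forall n : nat, (2 <= k n)%N) -> subpolynomial R k ->
     forall eps : R, 0 < eps ->
       (fun n : nat => (max_num_maximal_cliques R (k n) n)%:R : R^o)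
         =Omega_\oo (fun n : nat => n%:R `^ ((k n)%:R * (1 - eps)) : R^o))
  /\
  (forall k : nat, (2 <= k)%N ->
     (fun n : nat => (max_num_maximal_cliques R k n)%:R : R^o)
       =Omega_\oo (fun n : nat => n%:R ^+ k : R^o)).
Proof.
have key (k n : nat) : (0 < k <= n)%N ->
    (n%:R / (2 * k%:R)) ^+ k <= (max_num_maximal_cliques R k n)%:R :> R.
  move=> kn; have /andP[k0 _] := kn.
  apply: (@le_trans _ _ ((n %/ k)%:R ^+ k)).
    by apply: lerXn2r; rewrite ?nnegrE ?divr_ge0 ?mulr_ge0// divn_ge_half.
  by rewrite -natrX ler_nat max_num_maximal_cliques_ge.
split=> [k k2 k_sub eps eps0|k k2]; rewrite eqOmegaE qualifE; apply/asboolP.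
- pose e := Num.min eps 1.
  have e0 : 0 < e by rewrite lt_min eps0 ltr01.
  have e1 : e <= 1 by rewrite ge_min lexx orbT.
  have ee : e <= eps by rewrite ge_min lexx.
  exists 1 => //; near=> n; rewrite mul1r ger0_norm ?powR_ge0// ger0_norm//.
  have k0 : (0 < k n)%N by exact: ltnW.
  (* The factor n^e is split in two halves, one absorbing [k n] and the other the constant 2. *)
  have kn2 : (k n)%:R <= n%:R `^ (e / 2) :> R.
    by near: n; apply: k_sub; rewrite divr_gt0.
  have n2 : 2 <= n%:R `^ (e / 2) :> R.
    by near: n; apply: (@subpolynomial_cst R 2 (e / 2)); rewrite divr_gt0.
  have kn : (k n <= n)%N.
    rewrite -(ler_nat R); apply: le_trans (_ : n%:R `^ 1 <= _); last by rewrite powRr1.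
    by near: n; exact: k_sub.
  have n1 : 1 <= n%:R :> R by rewrite ler1n (leq_trans k0).
  have n0 : 0 < n%:R :> R by exact: lt_le_trans n1.
  apply: le_trans (key _ _ _); last by rewrite k0.
  (* Both sides become [k n]-th powers, so comparing bases suffices, however [k n] grows. *)
  rewrite mulrC powRrM powR_mulrn ?powR_ge0//.
  apply: lerXn2r; rewrite ?nnegrE ?powR_ge0 ?divr_ge0 ?mulr_ge0//.
  apply: (@le_trans _ _ (n%:R `^ (1 - e))).
    by rewrite ler_powR// lerB.
  rewrite ler_pdivlMr ?mulr_gt0 ?ltr0n//.
  have {2}-> : n%:R = n%:R `^ (1 - e) * (n%:R `^ (e / 2) * n%:R `^ (e / 2)) :> R.
    by rewrite -!powRD ?(gt_eqF n0) ?implybT// -splitr subrK powRr1 ?ltW.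
  by rewrite ler_wpM2l ?powR_ge0// ler_pM.
- have k0 : (0 < k)%N by exact: ltnW.
  exists ((2 * k%:R) ^- k); first by rewrite invr_gt0 exprn_gt0// mulr_gt0 ?ltr0n.
  near=> n; rewrite !ger0_norm ?exprn_ge0//.
  rewrite mulrC -expr_div_n; apply: key; rewrite k0.
  by near: n; exact: nbhs_infty_ge.
Unshelve. all: by end_near. Qed.
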